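(* Let $Y(t)$, $t\ge 0$, be the Markov branching process with non-homogeneous Poisson immigration, with particle lifetime parameter $\mu>0$, offspring probability generating function $f$, immigrant probability generating function $g$ and immigration intensity $r$, as defined in the context. Assume that: (a) $r(t)\to\rho$ as $t\to\infty$, for some constant $\rho>0$; (b) $f(s)=s+(1-s)^{\gamma+1}L\left(\frac{1}{1-s}\right)$ for $s\in[0,1)$, where $\gamma\in(0,1]$ and $L$ is a function slowly varying at infinity; (c) $g(s)=1-(1-s)^{\alpha}\,l\left(\frac{1}{1-s}\right)$ for $s\in(0,1)$, where $\alpha\in(0,1]$ and $l$ is a function slowly varying at infinity. Let $q(t)=1-g(F(t;0))$ and $Q(t)=\int_0^t q(u)\,du$ for $t\ge0$. Then: (i) If $Q(t)\to\infty$ as $t\to\infty$, then $\mathbf{P}\{Y(t)>0\}\to 1$ as $t\to\infty$. (ii) If $Q=\int_0^\infty q(u)\,du<\infty$, then $\mathbf{P}\{Y(t)>0\}\to 1-e^{-\rho Q}$ as $t\to\infty$.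
   Context: Let $Z(t)$, $t\ge0$, be the single-type continuous-time Markov branching process started from one particle at time $0$: particles evolve independently of each other, each lives an exponentially distributed time with distribution function $1-e^{-\mu t}$, $\mu>0$, and at the end of its life produces a random number $\xi\ge0$ of new particles, with offspring probability generating function (p.g.f.) $f(s)=\mathbf{E}[s^{\xi}]$. Its p.g.f. $F(t;s)=\mathbf{E}[s^{Z(t)}\mid Z(0)=1]$, $t\ge0$, $s\in[0,1]$, satisfies $\frac{\partial F(t;s)}{\partial t}=\mu[f(F(t;s))-F(t;s)]$ with $F(0;s)=s$ (and is the only solution in the class of p.g.f.s). Let $\nu(t)$ be a non-homogeneous Poisson process with intensity $r(t)\ge 0$ and mean measure $R(t)=\int_0^t r(u)\,du<\infty$, with jump points $0<S_1<S_2<\cdots$. Let $I_1,I_2,\dots$ be i.i.d. non-negative integer-valued random variables with p.g.f. $g(s)=\mathbf{E}[s^{I_k}]$. Let $\{Z^{(k,j)}\}_{k,j\ge1}$ be independent copies of $Z$. The Poisson process, the variables $I_k$, and the processes $Z^{(k,j)}$ are mutually independent. The Markov branching process with non-homogeneous Poisson immigration is $$Y(t)=\sum_{k=1}^{\nu(t)}\sum_{j=1}^{I_k}Z^{(k,j)}(t-S_k),\qquad t\ge0.$$ The functions $L$ and $l$ are positive on $[1,\infty)$; a positive function $\ell$ is slowly varying at infinity if $\ell(cx)/\ell(x)\to1$ as $x\to\infty$ for every $c>0$. *)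

(* Defs.v *)
From HB Require Import structures.
From mathcomp Require Export all_boot all_order all_algebra.
From mathcomp Require Export all_classical all_reals all_analysis.

Set Implicit Arguments.
Unset Strict Implicit.
Unset Printing Implicit Defensive.

Import Order.TTheory GRing.Theory Num.Theory.
Import numFieldNormedType.Exports.

Local Open Scope classical_set_scope.
Local Open Scope ring_scope.

(** * Independence and generating functions *)

(* Families of events are given as set systems, in practice sigma-algebras. *)
Definition mutually_independent (R : realType) (d : measure_display)
    (T : measurableType d) (P : probability T R) (I : eqType)
    (F : I -> set (set T)) : Prop :=
  forall (J : seq I) (E : I -> set T), uniq J ->
    (forall i, i \in J -> F i (E i)) ->
    P (\bigcap_(i in [set` J]) E i) = (\prod_(i <- J) P (E i))%E.

Definition sigma_rv (d d' : measure_display) (T : measurableType d)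
    (T' : measurableType d') (X : T -> T') : set (set T) :=
  preimage_set_system setT X measurable.

Definition sigma_process (R : realType) (d : measure_display)
    (T : measurableType d) (X : R -> T -> nat) : set (set T) :=
  <<s \bigcup_(t in [set t : R | 0 <= t]) sigma_rv (X t) >>.

(* With the convention 0 ^+ 0 = 1, [pgf P X 0] is P(X = 0). *)
Definition pgf (R : realType) (d : measure_display) (T : measurableType d)
    (P : probability T R) (X : T -> nat) (s : R) : R :=
  fine 'E_P[fun w => (s ^+ X w)%R]%E.

Definition has_pgf (R : realType) (d : measure_display) (T : measurableType d)
    (P : probability T R) (X : T -> nat) (h : R -> R) : Prop :=
  measurable_fun setT X /\ forall s, 0 <= s <= 1 -> pgf P X s = h s.

(** * The Markov branching process started from one particle *)

(* Particles carry Ulam-Harris labels, read from the youngest generation back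
   to the ancestor [::] : the j-th child (j = 0, 1, ...) of v is j :: v. *)
Fixpoint realized (T : Type) (xi : seq nat -> T -> nat) (v : seq nat) (w : T)
    : bool :=
  if v is j :: v' then realized xi v' w && (j < xi v' w)%N else true.

Fixpoint birth (R : realType) (T : Type) (tau : seq nat -> T -> R)
    (v : seq nat) (w : T) : R :=
  if v is _ :: v' then birth tau v' w + tau v' w else 0.

Definition alive (R : realType) (T : Type) (tau : seq nat -> T -> R)
    (xi : seq nat -> T -> nat) (t : R) (w : T) : set (seq nat) :=
  [set v | realized xi v w /\ birth tau v w <= t < birth tau v w + tau v w].

(* [Z t] is the number of particles alive at time t, almost surely for all
   t >= 0 simultaneously. *)
Definition markov_branching_process (R : realType) (d : measure_display)
    (T : measurableType d) (P : probability T R) (mu : R) (f : R -> R)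
    (Z : R -> T -> nat) : Prop :=
  (forall t, 0 <= t -> measurable_fun setT (Z t)) /\
  exists (tau : seq nat -> T -> R) (xi : seq nat -> T -> nat),
  [/\ forall v, measurable_fun setT (tau v) /\
        (forall t, 0 <= t ->
           P [set w | tau v w <= t] = (1 - expR (- (mu * t)))%:E),
      forall v, has_pgf P (xi v) f,
      mutually_independent P (fun i : (seq nat + seq nat)%type =>
        match i with
        | inl v => sigma_rv (tau v)
        | inr v => sigma_rv (xi v)
        end) &
      {ae P, forall w, forall t : R, 0 <= t -> (alive tau xi t w #= `I_(Z t w))%card}].

(* [Z'] has the law of [Z] : same finite-dimensional distributions, and
   right-continuous (for the discrete topology of nat) sample paths. *)
Definition copy_of (R : realType) (d0 : measure_display)
    (T0 : measurableType d0) (P0 : probability T0 R) (Z : R -> T0 -> nat)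
    (d : measure_display) (T : measurableType d) (P : probability T R)
    (Z' : R -> T -> nat) : Prop :=
  [/\ forall t, 0 <= t -> measurable_fun setT (Z' t),
      forall w t, 0 <= t -> \forall u \near t^'+, Z' u w = Z' t w &
      forall c : seq (R * nat), (forall x, x \in c -> 0 <= x.1) ->
        P [set w | forall x, x \in c -> Z' x.1 w = x.2] =
        P0 [set w | forall x, x \in c -> Z x.1 w = x.2]].

(** * Poisson immigration *)

Definition mean_measure (R : realType) (r : R -> R) (t : R) : R :=
  \int[lebesgue_measure]_(u in `[0, t]) r u.

Definition intensity (R : realType) (r : R -> R) : Prop :=
  (forall t, 0 <= t -> 0 <= r t) /\
  (forall t, 0 <= t ->
     lebesgue_measure.-integrable `[0, t] (fun u => (r u)%:E)).

(* The law of an increment is written out because the library's [poisson_pmf]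
   is not the point mass at 0 when its parameter is 0. *)
Definition poisson_process (R : realType) (d : measure_display)
    (T : measurableType d) (P : probability T R) (r : R -> R)
    (nu : R -> T -> nat) : Prop :=
  [/\ forall t, 0 <= t -> measurable_fun setT (nu t),
      forall w, nu 0 w = 0%N,
      forall s t w, 0 <= s <= t -> (nu s w <= nu t w)%N,
      forall s t n, 0 <= s <= t ->
        let m := mean_measure r t - mean_measure r s in
        P [set w | (nu t w - nu s w)%N = n] =
        (m ^+ n / n`!%:R * expR (- m))%:E &
      forall t : nat -> R, 0 <= t 0%N -> nondecreasing_seq t ->
        mutually_independent P
          (fun i => sigma_rv (fun w => (nu (t i.+1) w - nu (t i) w)%N))].

(* Indices are shifted: [S k] is the (k+1)-st jump point. *)
Definition jump_points (R : realType) (T : Type) (nu : R -> T -> nat)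
    (S : nat -> T -> R) : Prop :=
  forall w, [/\ 0 < S 0%N w,
    forall k, S k w < S k.+1 w &
    forall t k, 0 <= t -> (k < nu t w)%N = (S k w <= t)].

(* The sources of randomness of the process with immigration, mutual
   independence of which is assumed: [None] is the Poisson process,
   [Some (inl k)] the size of the k-th group of immigrants, and
   [Some (inr (k, j))] the process started by its j-th member. *)
Definition sources (R : realType) (d : measure_display) (T : measurableType d)
    (nu : R -> T -> nat) (I : nat -> T -> nat)
    (Zc : nat -> nat -> R -> T -> nat)
    (i : option (nat + nat * nat)) : set (set T) :=
  match i with
  | None => sigma_process nu
  | Some (inl k) => sigma_rv (I k)
  | Some (inr kj) => sigma_process (Zc kj.1 kj.2)
  end.

Definition immigration_process (R : realType) (T : Type)
    (nu : R -> T -> nat) (S : nat -> T -> R) (I : nat -> T -> nat)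
    (Zc : nat -> nat -> R -> T -> nat) (t : R) (w : T) : nat :=
  (\sum_(k < nu t w) \sum_(j < I k w) Zc k j (t - S k w)%R w)%N.

(** * Slow variation *)

Definition slowly_varying (R : realType) (L : R -> R) : Prop :=
  (forall x, 1 <= x -> 0 < L x) /\
  (forall c, 0 < c -> L (c * x) / L x @[x --> +oo] --> (1 : R)).

(* Main.v *)
Require Import Defs.
From mathcomp Require Import measurable_realfun ring lra.
Import Order.TTheory GRing.Theory Num.Theory.
Import numFieldNormedType.Exports.
Local Open Scope classical_set_scope.
Local Open Scope ring_scope.

(** Zero is absorbing for the branching process, so q is nonincreasing with
    values in [0, 1], and a group of immigrants that arrived at time u is
    extinct at time t with probability 1 - q(t - u). Thinning the Poisson
    process of arrivals by survival suggests
    P(Y(t) = 0) = exp(- int_0^t r(u) q(t - u) du), and since r tends to rho the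
    integral tends to rho * Q.

    The proof works with partitions of [0, t] in place of the integral: every
    arrival of a cell is moved to one end of that cell. By absorption this
    changes the event Y(t) = 0 monotonically, and after the move the
    probability is computed exactly by [cells_extinct]: the numbers of arrivals
    in the cells are independent Poisson variables and, given them, everything
    is a finite intersection of independent events. The result is
    [probability_extinct_bounds], which squeezes P(Y(t) = 0) between exp(- U) and
    exp(- L), with U and L the upper and lower Darboux sums of u |-> q(t - u) with
    respect to the mean measure of the immigration.

    For the limit, [grid_bounds] takes cells of length h counted backwards from
    t, as far back as r remains close to rho, and one large cell for the
    remaining early times. The fine cells give rho times a Riemann sum of q.
    The early cell contributes at most its mean measure, which stays bounded,
    times the value of q at a late time; this vanishes when q is integrable,
    because u * q(u) <= Q(u) for nonincreasing q. When Q(t) tends to infinity,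
    the fine cells alone make the upper bound vanish. *)

Set Implicit Arguments.
Unset Strict Implicit.
Unset Printing Implicit Defensive.

(** * Nonnegative integer-valued random variables *)

Lemma measurable_nat_fiber d (T : measurableType d) (X : T -> nat) (A : set nat) :
  measurable_fun setT X -> measurable [set w | A (X w)].
Proof.
by move=> mX; rewrite -[X in measurable X]setTI; exact: mX.
Qed.

Lemma le_measure_negligible d (T : measurableType d) (R : realType)
    (P : probability T R) (A B N : set T) :
  measurable A -> measurable B -> P.-negligible N ->
  A `<=` B `|` N -> (P A <= P B)%E.
Proof.
move=> mA mB [M [mM M0 NM]] ABN.
rewrite -(measureU0 mB mM M0); apply: le_measure; rewrite ?inE//.
  exact: measurableU.
by move=> w /ABN[|/NM]; [left|right].
Qed.

Lemma measure_nat_fibers d (T : measurableType d) (R : realType)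
    (P : probability T R) (X : T -> nat) (B : set T) :
  measurable_fun setT X -> measurable B ->
  P B = (\sum_(m <oo) P (B `&` [set w | X w = m]))%E.
Proof.
move=> mX mB.
have mF m : measurable (B `&` [set w | X w = m]).
  by apply: measurableI => //; exact: (@measurable_nat_fiber _ _ _ [set m]).
have BE : B = \bigcup_m (B `&` [set w | X w = m]).
  by apply/seteqP; split => [w Bw|w [m _ []]//]; exists (X w).
rewrite [in LHS]BE measure_semi_bigcup//=; last by rewrite -BE.
apply/trivIsetP => i j _ _ ij.
by apply/seteqP; split => // w [[_ /= Xi] [_ /= Xj]]; rewrite -Xi -Xj eqxx in ij.
Qed.

(** A weight that factorises over the values of the X l sums to the product of
    the one-dimensional sums. It is applied once to the numbers of arrivals in
    the cells of a partition and once to the sizes of the groups of immigrants;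
    its last hypothesis then follows from independence of finitely many explicit
    events. *)
Lemma total_probability_prod d (T : measurableType d) (R : realType)
    (P : probability T R) (X : nat -> T -> nat) (B : set T)
    (b : nat -> nat -> R) (beta : nat -> R) (e : R) (n : nat) :
  (forall l, (l < n)%N -> measurable_fun setT (X l)) -> measurable B ->
  (forall l m, 0 <= b l m) ->
  (forall l, (l < n)%N -> (\sum_(m <oo) (b l m)%:E)%E = (beta l)%:E) ->
  (forall v : nat -> nat,
    P (B `&` [set w | forall l, (l < n)%N -> X l w = v l]) =
    (e * \prod_(l < n) b l (v l))%:E) ->
  P B = (e * \prod_(l < n) beta l)%:E.
Proof.
elim: n B e => [|n IHn] B e mX mB b0 bE H.
  have := H (fun=> 0%N); rewrite !big_ord0 => <-; congr (P _).
  by apply/seteqP; split => w //= [].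
have mXn : measurable_fun setT (X n) by exact: mX.
rewrite (measure_nat_fibers P mXn mB) big_ord_recr/=.
rewrite mulrA EFinM -bE// -nneseriesZl; last by move=> m _; rewrite lee_fin.
apply: eq_eseriesr => m _.
(* Once the value of X n is fixed, its weight joins the constant e. *)
rewrite -EFinM mulrAC; apply: IHn => //.
- by move=> l ln; apply: mX; rewrite ltnW.
- by apply: measurableI => //; exact: (@measurable_nat_fiber _ _ _ [set m]).
- by move=> l ln; apply: bE; rewrite ltnW.
move=> v; have := H (fun l => if l == n then m else v l).
rewrite big_ord_recr/= eqxx => vE.
rewrite -mulrA [b n m * _]mulrC.
rewrite (eq_bigr (fun i : 'I_n => b i (if i == n :> nat then m else v i))); last first.
  by move=> i _; rewrite ltn_eqF.
rewrite -vE; congr (P _); apply/seteqP; split => w /=.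
  move=> [[Bw Xn] Xl]; split => // l; rewrite ltnS leq_eqVlt.
  by case: eqP => [->//|_ /=]; exact: Xl.
move=> [Bw Xl]; split; first by split => //; rewrite Xl// eqxx.
by move=> l ln; rewrite Xl ?ltn_eqF// ltnW.
Qed.

Lemma expr_01 (R : realType) (s : R) n : 0 <= s <= 1 -> 0 <= s ^+ n <= 1.
Proof. by move=> /andP[s0 s1]; rewrite exprn_ge0//= exprn_ile1. Qed.

Lemma expectation_pow d (T : measurableType d) (R : realType)
    (P : probability T R) (X : T -> nat) (s : R) :
  measurable_fun setT X -> 0 <= s <= 1 ->
  'E_P[fun w => (s ^+ X w)%R]%E =
  (\sum_(m <oo) (P [set w | X w = m] * (s ^+ m)%:E))%E.
Proof.
move=> mX s01; rewrite unlock.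
have -> : (setT : set T) = \bigcup_m [set w | X w = m].
  by apply/seteqP; split => // w _; exists (X w).
rewrite ge0_integral_bigcup//=.
- apply: eq_eseriesr => m _.
  rewrite (eq_integral (fun=> (s ^+ m)%:E)); last by move=> w; rewrite inE/= => ->.
  by rewrite integral_cst; [rewrite muleC | exact: (@measurable_nat_fiber _ _ _ [set m])].
- by move=> m; exact: (@measurable_nat_fiber _ _ _ [set m]).
- apply/measurable_EFinP.
  apply: (measurable_funS measurableT) => //.
  exact: (measurableT_comp (f := fun m : nat => s ^+ m)).
- by move=> w _; rewrite lee_fin; case/andP: (expr_01 (X w) s01).
- by apply/trivIsetP => i j _ _ ij; apply/seteqP; split => // w [/= Xi Xj];
    rewrite -Xi -Xj eqxx in ij.
Qed.

Lemma expectation_pow_01 d (T : measurableType d) (R : realType)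
    (P : probability T R) (X : T -> nat) (s : R) :
  measurable_fun setT X -> 0 <= s <= 1 ->
  (0 <= 'E_P[fun w => (s ^+ X w)%R] <= 1)%E.
Proof.
move=> mX s01; apply/andP; split.
  by apply: expectation_ge0 => w; case/andP: (expr_01 (X w) s01).
rewrite -(@expectation_cst _ _ _ P 1) unlock; apply: ge0_le_integral => //=.
- by move=> w _; rewrite lee_fin; case/andP: (expr_01 (X w) s01).
- by apply/measurable_EFinP; exact: (measurableT_comp (f := fun m : nat => s ^+ m)).
- by move=> w _; rewrite lee_fin; case/andP: (expr_01 (X w) s01).
Qed.

Lemma pgf_EFin d (T : measurableType d) (R : realType)
    (P : probability T R) (X : T -> nat) (s : R) :
  measurable_fun setT X -> 0 <= s <= 1 ->
  (pgf P X s)%:E = 'E_P[fun w => (s ^+ X w)%R]%E.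
Proof.
move=> mX s01; have /andP[e0 e1] := expectation_pow_01 P mX s01.
by rewrite /pgf fineK// ge0_fin_numE// (le_lt_trans e1)// ltry.
Qed.

Lemma pgf_01 d (T : measurableType d) (R : realType)
    (P : probability T R) (X : T -> nat) (s : R) :
  measurable_fun setT X -> 0 <= s <= 1 -> 0 <= pgf P X s <= 1.
Proof.
by move=> mX s01; rewrite -!lee_fin pgf_EFin//; exact: expectation_pow_01.
Qed.

Lemma pgf0 d (T : measurableType d) (R : realType)
    (P : probability T R) (X : T -> nat) :
  measurable_fun setT X -> (pgf P X 0)%:E = P [set w | X w = 0%N].
Proof.
move=> mX; rewrite pgf_EFin ?lexx//; last by rewrite ler01.
rewrite -expectation_indic; last exact: (@measurable_nat_fiber _ _ _ [set 0%N]).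
congr ('E_P[_]%E); apply/funext => w; rewrite expr0n indicE; congr ((nat_of_bool _)%:R).
by apply/eqP/idP; rewrite inE.
Qed.

Lemma le_pgf d (T : measurableType d) (R : realType)
    (P : probability T R) (X : T -> nat) (s t : R) :
  measurable_fun setT X -> 0 <= s -> s <= t -> t <= 1 -> pgf P X s <= pgf P X t.
Proof.
move=> mX s0 st t1; have t0 := le_trans s0 st; have s1 := le_trans st t1.
rewrite -lee_fin !pgf_EFin ?s0 ?t0// unlock; apply: ge0_le_integral => //=.
- by move=> w _; rewrite lee_fin exprn_ge0.
- by apply/measurable_EFinP; exact: (measurableT_comp (f := fun m : nat => s ^+ m)).
- by apply/measurable_EFinP; exact: (measurableT_comp (f := fun m : nat => t ^+ m)).
- by move=> w _; rewrite lee_fin lerXn2r// nnegrE.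
Qed.

Lemma poisson_pgf (R : realType) (m a : R) : 0 <= m -> 0 <= a ->
  (\sum_(v <oo) (((m ^+ v / v`!%:R * expR (- m))%:E * (a ^+ v)%:E)) =
   (expR (- (m * (1 - a))))%:E)%E.
Proof.
move=> m0 a0.
have -> : - (m * (1 - a)) = - m + m * a by ring.
rewrite expRD EFinM.
under eq_eseriesr => v _ do
  rewrite -EFinM mulrAC mulrC EFinM [_ / _ * _]mulrAC -exprMn.
rewrite nneseriesZl/=; last first.
  by move=> n _; rewrite lee_fin divr_ge0// exprn_ge0// mulr_ge0.
congr (_ * _)%E; rewrite expRE -EFin_lim; last first.
  rewrite /pseries/=; under eq_fun do rewrite mulrC.
  exact: is_cvg_series_exp_coeff.
apply/congr_lim/funext => n/=; rewrite /pseries/= /series/= -sumEFin//.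
by under eq_bigr do rewrite mulrC.
Qed.

(** * Absorption at zero *)

(** Along the line of descent of v each individual is born when the previous one
    dies, so the lifetimes cover the time from 0 to the death of v and one of
    them contains s. *)
Lemma alive_ancestor (R : realType) (T : Type) (tau : seq nat -> T -> R)
    (xi : seq nat -> T -> nat) (s : R) (w : T) (v : seq nat) :
  0 <= s -> realized xi v w -> s < birth tau v w + tau v w ->
  alive tau xi s w !=set0.
Proof.
move=> s0; elim: v => [|j v IHv] vr sv.
  by exists [::]; split => //=; rewrite s0.
have [bs|sb] := leP (birth tau (j :: v) w) s.
  by exists (j :: v); split => //; rewrite bs.
by apply: IHv sb; case/andP: vr.
Qed.

Lemma alive_earlier (R : realType) (T : Type) (tau : seq nat -> T -> R)
    (xi : seq nat -> T -> nat) (s t : R) (w : T) :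
  0 <= s <= t -> alive tau xi s w = set0 -> alive tau xi t w = set0.
Proof.
move=> /andP[s0 st] As; apply: contrapT => /eqP/set0P[v [vr /andP[_ tv]]].
have /set0P := alive_ancestor s0 vr (le_lt_trans st tv).
by rewrite As eqxx.
Qed.

Lemma branching_zero_absorbing d (T : measurableType d) (R : realType)
    (P : probability T R) (mu : R) (f : R -> R) (Z : R -> T -> nat) (s t : R) n :
  markov_branching_process P mu f Z -> 0 <= s <= t ->
  P [set w | Z s w = 0%N /\ Z t w = n.+1] = 0%E.
Proof.
move=> [mZ [tau [xi [_ _ _ ZE]]]] st; have /andP[s0 _] := st.
have t0 : 0 <= t by case/andP: st => ?; exact: le_trans.
apply: measure_negligible.
  apply: measurableI; first exact: (@measurable_nat_fiber _ _ _ [set 0%N] (mZ _ s0)).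
  exact: (@measurable_nat_fiber _ _ _ [set n.+1] (mZ _ t0)).
apply: negligibleS ZE => w /= [Zs Zt] wE.
have := wE _ s0; rewrite Zs II0 card_eq0 => /eqP As.
have := wE _ t0; rewrite Zt (alive_earlier st As).
by rewrite card_eq_sym card_eq0 => /eqP E; have : `I_n.+1 0%N by []; rewrite E.
Qed.

(** A copy shares with Z only finite-dimensional laws, hence at this stage one
    null set for each pair of times. *)
Lemma copy_zero_absorbing d0 (T0 : measurableType d0) (R : realType)
    (P0 : probability T0 R) (Z : R -> T0 -> nat) (mu : R) (f : R -> R)
    d (T : measurableType d) (P : probability T R) (Z' : R -> T -> nat) (s t : R) :
  markov_branching_process P0 mu f Z -> copy_of P0 Z P Z' -> 0 <= s <= t ->
  P.-negligible [set w | Z' s w = 0%N /\ Z' t w <> 0%N].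
Proof.
move=> ZP [mZ' _ fdd] st; have /andP[s0 _] := st.
have t0 : 0 <= t by case/andP: st => ?; exact: le_trans.
apply: (@negligibleS _ _ _ _ (\bigcup_n [set w | Z' s w = 0%N /\ Z' t w = n.+1])).
  by move=> w /= [Zs /eqP]; rewrite -lt0n => Zt; exists (Z' t w).-1 => //=; rewrite prednK.
apply: negligible_bigcup => n; apply/negligibleP.
  apply: measurableI; first exact: (@measurable_nat_fiber _ _ _ [set 0%N] (mZ' _ s0)).
  exact: (@measurable_nat_fiber _ _ _ [set n.+1] (mZ' _ t0)).
rewrite -(branching_zero_absorbing n ZP st).
have H : forall x, x \in [:: (s, 0%N); (t, n.+1)] -> 0 <= x.1.
  by move=> x; rewrite !inE => /orP[] /eqP ->.
transitivity (P [set w | forall x, x \in [:: (s, 0%N); (t, n.+1)] -> Z' x.1 w = x.2]).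
  congr (P _); apply/seteqP; split => w /=.
    by move=> [Zs Zt] x; rewrite !inE => /orP[] /eqP ->.
  move=> wE; split; [apply: (wE (s, 0%N))|apply: (wE (t, n.+1))];
  by rewrite !inE eqxx ?orbT.
rewrite fdd//; congr (P0 _); apply/seteqP; split => w /=.
  move=> wE; split; [apply: (wE (s, 0%N))|apply: (wE (t, n.+1))];
  by rewrite !inE eqxx ?orbT.
by move=> [Zs Zt] x; rewrite !inE => /orP[] /eqP ->.
Qed.

Lemma copy_marginal d0 (T0 : measurableType d0) (R : realType)
    (P0 : probability T0 R) (Z : R -> T0 -> nat)
    d (T : measurableType d) (P : probability T R) (Z' : R -> T -> nat) (t : R) n :
  copy_of P0 Z P Z' -> 0 <= t ->
  P [set w | Z' t w = n] = P0 [set w | Z t w = n].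
Proof.
move=> [_ _ fdd] t0.
have H : forall x, x \in [:: (t, n)] -> 0 <= x.1 by move=> x; rewrite inE => /eqP->.
have E (U : Type) (X : R -> U -> nat) : [set w | X t w = n] =
    [set w | forall x, x \in [:: (t, n)] -> X x.1 w = x.2].
  apply/seteqP; split => w /=; first by move=> Xt x; rewrite inE => /eqP->.
  by move=> wE; exact: (wE (t, n) (mem_head _ _)).
by rewrite !E fdd.
Qed.

Lemma right_continuous_rat (R : realType) (x : R -> nat) (t u : R) :
  (\forall v \near t^'+, x v = x t) -> t < u ->
  exists2 p : rat, t < ratr p < u & x (ratr p) = x t.
Proof.
move=> + tu; rewrite near_withinE => /nbhs_ballP[e /= e0 xt].
have [p] : exists p : rat, ratr p \in `]t, Num.min u (t + e)[.
  by apply: rat_in_itvoo; rewrite lt_min tu ltrDl.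
rewrite in_itv/= lt_min => /and3P[tp pu pe].
exists p; first by rewrite tp.
by apply: xt => //; rewrite -ball_normE/= ltr_distlC pe ltrBlDr (lt_trans tp)// ltrDl.
Qed.

(** The process will be evaluated at the random ages of the immigrants, so a
    single null set must serve all pairs of times. Pairs of rationals provide
    countably many null sets, and by right continuity the value at a real time
    is also taken at a rational just after it. *)
Lemma copy_zero_absorbing_path d0 (T0 : measurableType d0) (R : realType)
    (P0 : probability T0 R) (Z : R -> T0 -> nat) (mu : R) (f : R -> R)
    d (T : measurableType d) (P : probability T R) (Z' : R -> T -> nat) :
  markov_branching_process P0 mu f Z -> copy_of P0 Z P Z' ->
  {ae P, forall w, forall s t : R, 0 <= s <= t -> Z' s w = 0%N -> Z' t w = 0%N}.
Proof.
move=> ZP Z'P; have [_ rc _] := Z'P.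
pose bad (pq : rat * rat) := [set w |
  0 <= (ratr pq.1 : R) <= ratr pq.2 /\ (Z' (ratr pq.1) w = 0%N /\ Z' (ratr pq.2) w <> 0%N)].
apply: (@negligibleS _ _ _ _ (\bigcup_n oapp bad set0 (unpickle n))).
  move=> w /= /existsNP[s /existsNP[t /not_implyP[/andP[s0 st] /not_implyP[Zs Zt]]]].
  have {st} st : s < t by rewrite lt_neqAle st andbT; apply: contra_notN Zt => /eqP <-.
  have t0 : 0 <= t by rewrite (le_trans s0)// ltW.
  have tt1 : t < t + 1 by rewrite ltrDl.
  have [p /andP[sp pt] Zp] := right_continuous_rat (rc w s s0) st.
  have [q /andP[tq _] Zq] := right_continuous_rat (rc w t t0) tt1.
  exists (pickle (p, q)); first exact: Logic.I.
  rewrite pickleK; split; last by rewrite [fst _]/= [snd _]/= Zp Zq.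
  rewrite [fst _]/= [snd _]/=.
  by rewrite (le_trans s0 (ltW sp)) (ltW (lt_trans pt tq)).
apply: negligible_bigcup => n; case: (unpickle n) => [[p q]|]/=; last exact: negligible_set0.
have [pq|pq] := boolP (0 <= (ratr p : R) <= ratr q).
  by apply: negligibleS (copy_zero_absorbing ZP Z'P pq) => w [].
by apply: negligibleS (negligible_set0 _) => w [] /=; rewrite (negbTE pq).
Qed.

(** A right-continuous path in nat vanishes at u if and only if it vanishes at
    all rationals between u and some later rational q. In this description the
    random time enters only through comparisons with rationals. *)
Lemma measurable_zero_at_random_time (R : realType) d (T : measurableType d)
    (X : R -> T -> nat) (U : T -> R) :
  (forall t, 0 <= t -> measurable_fun setT (X t)) ->
  (forall w t, 0 <= t -> \forall u \near t^'+, X u w = X t w) ->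
  measurable_fun setT U ->
  measurable [set w | 0 <= U w /\ X (U w) w = 0%N].
Proof.
move=> mX rc mU.
have -> : [set w | 0 <= U w /\ X (U w) w = 0%N] =
  [set w | 0 <= U w] `&` \bigcup_(q : rat) ([set w | U w < ratr q] `&`
     ~` \bigcup_(p : rat) ([set w | U w < ratr p] `&`
          [set w | (ratr p : R) < ratr q /\ 0 <= (ratr p : R) /\ X (ratr p) w <> 0%N])).
  apply/seteqP; split => w /=.
    move=> [U0 XU]; split => //.
    have := rc w _ U0; rewrite near_withinE => /nbhs_ballP[e /= e0 Xe].
    have [q] : exists q : rat, ratr q \in `](U w), (U w + e)[.
      by apply: rat_in_itvoo; rewrite ltrDl.
    rewrite in_itv/= => /andP[Uq qe]; exists q => //; split => //.
    move=> [p _ [/= Up [pq [p0 /eqP]]]]; rewrite Xe ?XU//.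
    rewrite -ball_normE/= ltr_distlC (lt_trans pq qe) ltrBlDr (lt_trans Up)//.
    by rewrite ltrDl.
  move=> [U0 [q _ [/= Uq nX]]]; split => //.
  have [p /andP[Up pq] <-] := right_continuous_rat (rc w _ U0) Uq.
  apply: contrapT => Xp; apply: nX; exists p => //; split => //=.
  by split => //; split => //; rewrite ltW// (le_lt_trans U0).
have mlt (a : R) : measurable [set w | U w < a].
  have -> : [set w | U w < a] = setT `&` U @^-1` `]-oo, a[.
    by rewrite setTI; apply/seteqP; split => w /=; rewrite in_itv.
  exact: mU.
apply: measurableI.
  have -> : [set w | 0 <= U w] = setT `&` U @^-1` `[0, +oo[.
    by rewrite setTI; apply/seteqP; split => w /=; rewrite in_itv/= andbT.
  exact: mU.
apply: bigcupT_measurable_rat => q; apply: measurableI => //.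
apply: measurableC; apply: bigcupT_measurable_rat => p; apply: measurableI => //.
have [pq|pq] := boolP ((ratr p : R) < ratr q); last first.
  by rewrite (_ : mkset _ = set0)//; apply/seteqP; split => // w [].
have [p0|p0] := boolP (0 <= (ratr p : R)); last first.
  by rewrite (_ : mkset _ = set0)//; apply/seteqP; split => // w [_ []].
rewrite (_ : mkset _ = [set w | (X (ratr p) w <> 0%N)]); last first.
  by apply/seteqP; split => // w [_ []].
exact: (@measurable_nat_fiber _ _ _ [set n | n <> 0%N] (mX _ p0)).
Qed.

Lemma measurable_forall_nat d (T : measurableType d) (A : nat -> T -> Prop) :
  (forall k, measurable [set w | A k w]) -> measurable [set w | forall k, A k w].
Proof.
move=> mA; rewrite (_ : mkset _ = \bigcap_k [set w | A k w]).
  exact: bigcapT_measurable.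
by apply/seteqP; split => [w Aw k _|w Aw k] /=; [exact: Aw|exact: Aw].
Qed.

Lemma measurable_implies d (T : measurableType d) (A B : T -> Prop) :
  measurable [set w | A w] -> measurable [set w | B w] ->
  measurable [set w | A w -> B w].
Proof.
move=> mA mB; rewrite (_ : mkset _ = ~` [set w | A w] `|` [set w | B w]).
  by apply: measurableU => //; exact: measurableC.
apply/seteqP; split => w /=; last by move=> [nA /nA|].
by move=> AB; have [/AB|] := pselect (A w); [right|left].
Qed.

(** * Numbering the arrivals in the cells of a partition *)

Lemma cell_of_index (u : nat -> nat) n k : u 0%N = 0%N -> (k < u n)%N ->
  exists2 l, (l < n)%N & (u l <= k < u l.+1)%N.
Proof.
move=> u0; elim: n => [|n IHn]; first by rewrite u0.
have [kn _|nk kn] := ltnP k (u n).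
  by have [l ln lk] := IHn kn; exists l => //; rewrite ltnW.
by exists n => //; rewrite nk kn.
Qed.

Section counting.
Context (R : realType) (v : nat -> nat) (s : nat -> R).
Local Notation ps := (fun l => (\sum_(i < l) v i)%N).

(** When v l groups arrive in cell l, the groups numbered k with
    ps l <= k < ps l.+1 are those of cell l. The times s attached to the cells thus become times c
    attached to the groups. *)
Lemma index_times n : exists c : nat -> R,
  (forall l k, (l < n)%N -> (ps l <= k < ps l.+1)%N -> c k = s l) /\
  (forall a : R -> R, \prod_(k < ps n) a (c k) = \prod_(l < n) a (s l) ^+ v l).
Proof.
elim: n => [|n [c [cE cP]]].
  by exists s; split => // a; rewrite !big_ord0.
have ps_le l : (l <= n)%N -> (ps l <= ps n)%N.
  move=> ln; rewrite -(subnKC ln); elim: (n - l)%N => [|i IHi]; first by rewrite addn0.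
  by rewrite addnS big_ord_recr/= (leq_trans IHi)// leq_addr.
exists (fun k => if (k < ps n)%N then c k else s n); split => [l k|a].
  rewrite ltnS leq_eqVlt => /predU1P[->|ln] /andP[lk kl].
    by rewrite ltnNge lk.
  by rewrite (leq_trans kl (ps_le _ ln)) (cE l)// lk kl.
rewrite [RHS]big_ord_recr/= -cP.
rewrite -!(big_mkord xpredT (fun k => a (if (k < ps n)%N then c k else s n))).
rewrite -(big_mkord xpredT (fun k => a (c k))) [in LHS]big_ord_recr/=.
rewrite (big_cat_nat _ (n := ps n))//= ?leq_addr//; congr (_ * _).
  by apply: eq_big_nat => k /andP[_ ->].
rewrite (eq_big_nat _ _ (F2 := fun=> a (s n))); last first.
  by move=> k /andP[nk _]; rewrite ltnNge nk.
by rewrite prodr_const_nat addKn.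
Qed.
End counting.

(** * Events determined by a process *)

Section process_sigma_algebra.
Context (R : realType) (d : measure_display) (T : measurableType d)
  (nu : R -> T -> nat).

Local Notation process_space :=
  (g_sigma_algebraType (\bigcup_(t in [set t : R | 0 <= t]) sigma_rv (nu t))).

Lemma measurable_process (t : R) : 0 <= t ->
  measurable_fun setT (nu t : process_space -> nat).
Proof.
by move=> t0 _ Y mY; apply: sub_sigma_algebra; exists t => //; exists Y.
Qed.

Lemma sigma_process_increments (t : nat -> R) (v : nat -> nat) n :
  (forall l, 0 <= t l) ->
  sigma_process nu
    [set w | forall l, (l < n)%N -> (nu (t l.+1) w - nu (t l) w)%N = v l].
Proof.
move=> t0.
suff : measurable ([set w | forall l, (l < n)%N ->
    (nu (t l.+1) w - nu (t l) w)%N = v l] : set process_space) by [].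
apply: measurable_forall_nat => l.
apply: measurable_implies; first by case: (l < n)%N; rewrite ?set_true ?set_false.
apply: (@measurable_nat_fiber _ process_space
  (fun w => (nu (t l.+1) w - nu (t l) w)%N) [set v l]).
by apply: measurable_fun_subn; exact: measurable_process.
Qed.

Lemma sigma_process_fiber (t : R) (A : set nat) : 0 <= t ->
  sigma_process nu [set w | A (nu t w)].
Proof.
move=> t0; suff : measurable ([set w | A (nu t w)] : set process_space) by [].
exact: (measurable_nat_fiber _ (measurable_process t0)).
Qed.

End process_sigma_algebra.

(** * The mean measure *)

Lemma mean_measure_increment (R : realType) (r : R -> R) (s t : R) :
  intensity r -> 0 <= s <= t ->
  mean_measure r t - mean_measure r s = \int[lebesgue_measure]_(u in `]s, t]) r u.
Proof.
move=> [r0 ri] /andP[s0 st]; apply: Rintegral_itvB; rewrite ?bnd_simp//.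
by apply: ri; exact: le_trans st.
Qed.

Lemma mean_measure_le (R : realType) (r : R -> R) (s t : R) :
  intensity r -> 0 <= s <= t -> mean_measure r s <= mean_measure r t.
Proof.
move=> rP st; rewrite -subr_ge0 mean_measure_increment//.
apply: Rintegral_ge0 => u /=; rewrite in_itv/= => /andP[su _].
by apply: rP.1; case/andP: st => s0 _; rewrite (le_trans s0)// ltW.
Qed.

Section mean_measure_bounds.
Context (R : realType) (r : R -> R) (rP : intensity r).

Lemma mean_measure0 : mean_measure r 0 = 0.
Proof. by rewrite /mean_measure set_itv1 Rintegral_set1. Qed.

Lemma mean_measure_bounds (c1 c2 s t : R) : 0 <= s <= t ->
  (forall u, s < u <= t -> c1 <= r u <= c2) ->
  c1 * (t - s) <= mean_measure r t - mean_measure r s <= c2 * (t - s).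
Proof.
move=> st H; have [s0 le_st] := andP st.
have mu_st : lebesgue_measure `]s, t] = (t - s)%:E :> \bar R.
  rewrite lebesgue_measure_itv/= lte_fin; case: ltP => [|ts]; first by rewrite EFinB.
  by rewrite (@le_anti _ _ s t) ?le_st// subrr.
have ci c : lebesgue_measure.-integrable `]s, t] (EFin \o (fun=> c)).
  apply: measurable_bounded_integrable => //; last exact: bounded_cst.
  by have := ltry (t - s); rewrite -mu_st.
have cE c : c * (t - s) = \int[lebesgue_measure]_(u in `]s, t]) c.
  by rewrite Rintegral_cst// -[in LHS](_ : fine (t - s)%:E = t - s)// -mu_st.
have ri : lebesgue_measure.-integrable `]s, t] (EFin \o r).
  have t0 : 0 <= t by exact: le_trans le_st.
  apply: (integrableS _ _ _ (rP.2 t t0)) => //.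
  by apply: subset_itvr; rewrite bnd_simp.
rewrite mean_measure_increment// !cE; apply/andP; split; apply: le_Rintegral => // u /=;
  by rewrite in_itv/= => /H/andP[].
Qed.
End mean_measure_bounds.

(** * Extinction of the immigrants *)

Section immigration.
Context (R : realType) (d0 : measure_display) (T0 : measurableType d0)
  (P0 : probability T0 R) (mu : R) (f : R -> R) (Z : R -> T0 -> nat)
  (ZP : markov_branching_process P0 mu f Z)
  (d : measure_display) (T : measurableType d) (P : probability T R)
  (r : R -> R) (nu : R -> T -> nat) (S : nat -> T -> R)
  (g : R -> R) (I : nat -> T -> nat) (Zc : nat -> nat -> R -> T -> nat)
  (rP : intensity r) (nuP : poisson_process P r nu) (SP : jump_points nu S)
  (IP : forall k, has_pgf P (I k) g)
  (ZcP : forall k j, copy_of P0 Z P (Zc k j))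
  (indep : mutually_independent P (sources nu I Zc)).

Local Notation ext u := (pgf P0 (Z u) 0).
Local Notation a u := (g (ext u)).

Let mZ u : 0 <= u -> measurable_fun setT (Z u). Proof. by case: ZP => + _; apply. Qed.
Let mI k : measurable_fun setT (I k). Proof. by case: (IP k). Qed.
Let mZc k j u : 0 <= u -> measurable_fun setT (Zc k j u).
Proof. by case: (ZcP k j) => + _ _; apply. Qed.
Let mnu u : 0 <= u -> measurable_fun setT (nu u).
Proof. by case: nuP => + _ _ _ _; apply. Qed.

Lemma ext_01 u : 0 <= u -> 0 <= ext u <= 1.
Proof. by move=> u0; apply: pgf_01; [exact: mZ|rewrite lexx ler01]. Qed.

Lemma clan_ext_01 u : 0 <= u -> 0 <= a u <= 1.
Proof.
move=> /ext_01 e01; have [m <-//] := IP 0; exact: pgf_01.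
Qed.

Lemma probability_copy_extinct k j u : 0 <= u ->
  P [set w | Zc k j u w = 0%N] = (ext u)%:E.
Proof. by move=> u0; rewrite (copy_marginal 0 (ZcP k j) u0) pgf0//; exact: mZ. Qed.

Lemma ext_le (s t : R) : 0 <= s <= t -> ext s <= ext t.
Proof.
move=> st; have /andP[s0 s_le_t] := st; have t0 := le_trans s0 s_le_t.
rewrite -lee_fin -!(probability_copy_extinct 0 0)//.
apply: (le_measure_negligible _ _ (copy_zero_absorbing ZP (ZcP 0%N 0%N) st)).
- exact: (@measurable_nat_fiber _ _ _ [set 0%N] (mZc 0 0 s0)).
- exact: (@measurable_nat_fiber _ _ _ [set 0%N] (mZc 0 0 t0)).
by move=> w /= Zs; have [Zt|Zt] := pselect (Zc 0 0 t w = 0%N); [left|right].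
Qed.

Lemma clan_ext_le (s t : R) : 0 <= s <= t -> a s <= a t.
Proof.
move=> st; have /andP[s0 s_le_t] := st; have t0 := le_trans s0 s_le_t.
have [m gE] := IP 0; rewrite -!gE ?ext_01//.
by apply: le_pgf => //; [case/andP: (ext_01 s0)|exact: ext_le|case/andP: (ext_01 t0)].
Qed.

Let pI k m : R := fine (P [set w | I k w = m]).

Let pIE k m : P [set w | I k w = m] = (pI k m)%:E.
Proof.
rewrite /pI fineK// fin_num_measure//.
exact: (@measurable_nat_fiber _ _ _ [set m] (mI k)).
Qed.

(** A clan is a group of immigrants with all its descendants. Once the sizes of
    the groups are fixed, extinction of the first V clans at the times c is an
    intersection of finitely many events, each determined by one source. *)
Lemma clans_leaf (C : set T) (V : nat) (c : nat -> R) (m : nat -> nat) :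
  sigma_process nu C -> (forall k, (k < V)%N -> 0 <= c k) ->
  P (C `&` [set w | forall k, (k < V)%N ->
       I k w = m k /\ forall j, (j < m k)%N -> Zc k j (c k) w = 0%N]) =
  (P C * \prod_(k < V) (pI k (m k) * ext (c k) ^+ m k)%:E)%E.
Proof.
move=> nuC c0.
(* One event for each source, with J the list of the sources involved. *)
pose E (i : option (nat + nat * nat)) : set T := match i with
  | None => C
  | Some (inl k) => [set w | I k w = m k]
  | Some (inr kj) => [set w | Zc kj.1 kj.2 (c kj.1) w = 0%N]
  end.
pose Jr := [seq Some (inr (k, j)) : option (nat + nat * nat) |
              k <- iota 0 V, j <- iota 0 (m k)].
pose J := None :: [seq Some (inl k) | k <- iota 0 V] ++ Jr.
have JrP k j : (Some (inr (k, j)) \in Jr) = (k < V)%N && (j < m k)%N.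
  apply/allpairsPdep/andP => [[k' [j' []]]|[kV jm]].
    by rewrite !mem_iota /= !add0n => kV jm [-> ->].
  by exists k, j; rewrite !mem_iota.
have Jrl k : Some (inl k) \notin Jr by apply/negP => /allpairsPdep[? [? []]].
have Jrn : None \notin Jr by apply/negP => /allpairsPdep[? [? []]].
have JlP k : (Some (inl k) \in
    [seq Some (inl k) : option (nat + nat * nat) | k <- iota 0 V]) = (k < V)%N.
  by rewrite mem_map ?mem_iota// => x y [].
have := indep (J := J) (E := E).
have -> : C `&` [set w | forall k, (k < V)%N ->
       I k w = m k /\ forall j, (j < m k)%N -> Zc k j (c k) w = 0%N] =
    \bigcap_(i in [set` J]) E i.
  apply/seteqP; split => [w [Cw Gw] [[k|[k j]]|]//=|w Jw].
  - rewrite in_cons /= mem_cat JlP (negbTE (Jrl k)) orbF => kV.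
    by case: (Gw k kV).
  - rewrite in_cons /= mem_cat JrP => /orP[|/andP[kV jm]]; first by case/mapP.
    by case: (Gw k kV) => _; exact.
  - split; first by apply: (Jw None); rewrite /= inE.
    move=> k kV; split.
      by apply: (Jw (Some (inl k))); rewrite /= inE mem_cat JlP kV orbT.
    by move=> j jm; apply: (Jw (Some (inr (k, j)))); rewrite /= inE mem_cat JrP kV jm !orbT.
move=> ->.
- rewrite /J big_cons big_cat big_map big_allpairs_dep/=; congr (_ * _)%E.
  rewrite -big_split/= -(big_mkord xpredT (fun k => (pI k (m k) * ext (c k) ^+ m k)%:E)).
  rewrite /index_iota subn0 big_seq [RHS]big_seq; apply: eq_bigr => k.
  rewrite mem_iota/= => kV; rewrite EFinM pIE; congr (_ * _)%E.
  under eq_bigr do rewrite probability_copy_extinct ?c0//.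
  by rewrite prodEFin big_const_seq count_predT size_iota iter_mulr_1.
- rewrite /= mem_cat (negbTE Jrn) orbF; apply/andP; split.
    by apply/negP => /mapP[].
  rewrite cat_uniq map_inj_uniq ?iota_uniq//=; last by move=> x y [].
  apply/andP; split.
    by apply/hasPn => _ /allpairsPdep[k [j [_ _ ->]]]; apply/negP => /mapP[].
  apply: allpairs_uniq_dep; rewrite ?iota_uniq//; first by move=> *; exact: iota_uniq.
  by move=> [? ?] [? ?] _ _ [-> ->].
move=> [[k|[k j]]|]//=.
- by move=> _; exists [set m k] => //; rewrite setTI.
- rewrite in_cons /= mem_cat JrP => /orP[|/andP[kV jm]]; first by case/mapP.
  exact: (@sigma_process_fiber _ _ _ (Zc k j) (c k) [set 0%N] (c0 _ kV)).
Qed.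

(** Summing over the size of a group gives sum_m P(I = m) F^m = g(F). *)
Lemma clans_extinct (C : set T) (V : nat) (c : nat -> R) :
  measurable C -> sigma_process nu C -> (forall k, (k < V)%N -> 0 <= c k) ->
  P (C `&` [set w | forall k, (k < V)%N ->
       forall j, (j < I k w)%N -> Zc k j (c k) w = 0%N]) =
  (fine (P C) * \prod_(k < V) a (c k))%:E.
Proof.
move=> mC nuC c0.
(* The weights must be nonnegative at every index, also beyond V, where c is
   arbitrary. *)
pose c' k := Num.max 0 (c k).
apply: (@total_probability_prod _ _ _ _ I _
  (fun k m => pI k m * ext (c' k) ^+ m) (fun k => a (c k)) (fine (P C)) V) => //.
- apply: measurableI => //; apply: measurable_forall_nat => k.
  have [kV|kV] := boolP (k < V)%N; last first.
    by rewrite (_ : mkset _ = setT)//; apply/seteqP; split.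
  apply: measurable_implies; first by rewrite set_true.
  apply: measurable_forall_nat => j; apply: measurable_implies.
    exact: (@measurable_nat_fiber _ _ _ [set i | (j < i)%N] (mI k)).
  exact: (@measurable_nat_fiber _ _ _ [set 0%N] (mZc k j (c0 _ kV))).
- move=> k m; rewrite mulr_ge0 ?fine_ge0// exprn_ge0//.
  by have /ext_01/andP[] : 0 <= c' k by rewrite le_max lexx.
- move=> k kV; have [_ gE] := IP k.
  rewrite -gE ?ext_01 ?c0// pgf_EFin// ?ext_01 ?c0// expectation_pow ?ext_01 ?c0//.
  apply: eq_eseriesr => m _; rewrite pIE -EFinM /c'.
  by have /max_idPr -> := c0 _ kV.
move=> m; rewrite -setIA.
have -> : [set w | forall k, (k < V)%N ->
       forall j, (j < I k w)%N -> Zc k j (c k) w = 0%N] `&`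
    [set w | forall l, (l < V)%N -> I l w = m l] =
  [set w | forall k, (k < V)%N ->
       I k w = m k /\ forall j, (j < m k)%N -> Zc k j (c k) w = 0%N].
  apply/seteqP; split => w /=.
    by move=> [Gw Iw] k kV; split; [exact: Iw|rewrite -Iw//; exact: Gw].
  move=> Gw; split => k kV; last by case: (Gw k kV).
  by case: (Gw k kV) => ->.
rewrite clans_leaf// prodEFin EFinM fineK ?fin_num_measure//.
congr (_ * _%:E)%E; apply: eq_bigr => k _; rewrite /c'.
by have /max_idPr -> := c0 _ (ltn_ord k).
Qed.

Lemma measurable_cells (t s : nat -> R) (n : nat) :
  (forall l, 0 <= t l) -> (forall l, (l < n)%N -> 0 <= s l) ->
  measurable [set w | forall l, (l < n)%N ->
    forall k, (nu (t l) w <= k < nu (t l.+1) w)%N ->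
    forall j, (j < I k w)%N -> Zc k j (s l) w = 0%N].
Proof.
move=> t_ge0 s0; apply: measurable_forall_nat => l.
have [ln|ln] := boolP (l < n)%N; last first.
  by rewrite (_ : mkset _ = setT)//; apply/seteqP; split.
apply: measurable_implies; first by rewrite set_true.
apply: measurable_forall_nat => k; apply: measurable_implies.
  rewrite (_ : mkset _ = [set w | (nu (t l) w <= k)%N] `&` [set w | (k < nu (t l.+1) w)%N]).
    apply: measurableI.
      exact: (@measurable_nat_fiber _ _ _ [set i | (i <= k)%N] (mnu (t_ge0 l))).
    exact: (@measurable_nat_fiber _ _ _ [set i | (k < i)%N] (mnu (t_ge0 l.+1))).
  by apply/seteqP; split => w /= => [/andP[]//|[-> ->]].
apply: measurable_forall_nat => j; apply: measurable_implies.
  exact: (@measurable_nat_fiber _ _ _ [set i | (j < i)%N] (mI k)).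
exact: (@measurable_nat_fiber _ _ _ [set 0%N] (mZc k j (s0 _ ln))).
Qed.

(** Here all clans that arrive in the cell from t l to t l.+1 are inspected at the
    common age s l. They are extinct independently with probability a = a (s l),
    and the number N of them is a Poisson variable with mean m, so the cell
    contributes E[a^N] = exp(- m (1 - a)). *)
Lemma cells_extinct (t s : nat -> R) (n : nat) :
  t 0%N = 0 -> nondecreasing_seq t -> (forall l, (l < n)%N -> 0 <= s l) ->
  P [set w | forall l, (l < n)%N -> forall k, (nu (t l) w <= k < nu (t l.+1) w)%N ->
       forall j, (j < I k w)%N -> Zc k j (s l) w = 0%N] =
  (expR (- \sum_(l < n)
     (mean_measure r (t l.+1) - mean_measure r (t l)) * (1 - a (s l))))%:E.
Proof.
move=> t0 tnd s0; case: nuP => _ nu0 nu_le nu_poisson nu_indep.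
have t_ge0 l : 0 <= t l by rewrite -t0; exact: tnd.
have tS l : 0 <= t l <= t l.+1 by rewrite t_ge0 tnd.
pose m l := mean_measure r (t l.+1) - mean_measure r (t l).
have m0 l : 0 <= m l by rewrite subr_ge0 mean_measure_le.
pose N l w := (nu (t l.+1) w - nu (t l) w)%N.
pose p l v : R := m l ^+ v / v`!%:R * expR (- m l).
have p0 l v : 0 <= p l v by rewrite mulr_ge0 ?expR_ge0// divr_ge0// exprn_ge0.
have mN l : measurable_fun setT (N l) by apply: measurable_fun_subn; exact: mnu.
have NE l v : P [set w | N l w = v] = (p l v)%:E by exact: nu_poisson.
rewrite -sumrN expR_sum -[X in X%:E]mul1r.
apply: (@total_probability_prod _ _ _ _ N _
  (fun l v => p l v * a (Num.max 0 (s l)) ^+ v)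
  (fun l => expR (- (m l * (1 - a (s l))))) 1 n) => //.
- exact: measurable_cells.
- move=> l v; rewrite mulr_ge0// exprn_ge0//.
  by have /clan_ext_01/andP[] : 0 <= Num.max 0 (s l) by rewrite le_max lexx.
- move=> l ln; have /max_idPr -> := s0 _ ln.
  have /andP[a0 _] := clan_ext_01 (s0 _ ln).
  by rewrite -poisson_pgf//; apply: eq_eseriesr => v _; rewrite EFinM.
move=> v; rewrite mul1r.
pose C := [set w | forall l, (l < n)%N -> N l w = v l].
have nuC : sigma_process nu C by exact: sigma_process_increments.
have mC : measurable C.
  apply: measurable_forall_nat => l; apply: measurable_implies.
    by case: (l < n)%N; rewrite ?set_true ?set_false.
  exact: (@measurable_nat_fiber _ _ _ [set v l] (mN l)).
have PC : P C = (\prod_(l < n) p l (v l))%:E.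
  have := nu_indep t (t_ge0 0%N) tnd (iota 0 n) (fun l => [set w | N l w = v l]).
  have -> : \bigcap_(l in [set` iota 0 n]) [set w | N l w = v l] = C.
    apply/seteqP; split => w Cw l /=.
      by move=> ln; apply: (Cw l); rewrite /= mem_iota.
    by rewrite mem_iota /= add0n; exact: Cw.
  move=> ->; rewrite ?iota_uniq//; last first.
    by move=> l _; exists [set v l] => //; rewrite setTI.
  rewrite -prodEFin -(big_mkord xpredT (fun l => (p l (v l))%:E)) /index_iota subn0.
  by apply: eq_bigr => l _; rewrite NE.
have [c [cE cP]] := index_times v s n.
have nuE w : C w -> forall l, (l <= n)%N -> nu (t l) w = (\sum_(i < l) v i)%N.
  move=> Cw; elim => [|l IHl] ln; first by rewrite big_ord0 t0 nu0.
  rewrite big_ord_recr/= -IHl ?(ltnW ln)// -(Cw l ln) subnKC//.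
  by apply: nu_le; exact: tS.
set V := (\sum_(i < n) v i)%N.
have cellP k : (k < V)%N -> exists2 l, (l < n)%N &
    (\sum_(i < l) v i <= k < \sum_(i < l.+1) v i)%N.
  by apply: (@cell_of_index (fun l => \sum_(i < l) v i)%N); rewrite big_ord0.
have c0 k : (k < V)%N -> 0 <= c k.
  by move=> /cellP[l ln lk]; rewrite (cE l _ ln lk) s0.
transitivity (P (C `&` [set w | forall k, (k < V)%N ->
    forall j, (j < I k w)%N -> Zc k j (c k) w = 0%N])).
  congr (P _); rewrite setIC; apply/seteqP; split => w [Cw Gw]; split => //=.
    move=> k /cellP[l ln lk]; rewrite (cE l _ ln lk).
    by apply: (Gw l ln); rewrite !(nuE _ Cw)// ltnW.
  move=> l ln k; rewrite !(nuE _ Cw)//; last exact: ltnW.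
  move=> lk; rewrite -(cE l _ ln lk); apply: Gw; case/andP: lk => _ /leq_trans; apply.
  have := nu_le (t l.+1) (t n) w; rewrite !(nuE _ Cw)//; apply.
  by rewrite t_ge0 tnd.
rewrite clans_extinct// PC /= (cP (fun u => a u)) -big_split/=.
congr (_%:E); apply: eq_bigr => l _.
by have /max_idPr -> := s0 _ (ltn_ord l).
Qed.

Local Notation Y := (immigration_process nu S I Zc).

Lemma jump_point_gt0 k w : 0 < S k w.
Proof. by have [S0 SS _] := SP w; elim: k => // k /lt_trans; apply; exact: SS. Qed.

Lemma jump_point_le k w t : 0 <= t -> (k < nu t w)%N = (S k w <= t).
Proof. by move=> t0; have [_ _] := SP w; exact. Qed.

Lemma measurable_jump_point k : measurable_fun setT (S k).
Proof.
apply: (measurability (@RGenOInfty.G R)) => [|/= _ [_] [b] -> <-].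
  exact: RGenOInfty.measurableE.
rewrite setTI.
have -> : S k @^-1` `]b, +oo[ = ~` [set w | S k w <= b].
  apply/seteqP; split => w /=; rewrite in_itv/= andbT ltNge; first by move/negP.
  by move=> ?; apply/negP.
apply: measurableC; have [b0|b0] := leP 0 b.
  rewrite (_ : mkset _ = [set w | (k < nu b w)%N]).
    exact: (@measurable_nat_fiber _ _ _ [set i | (k < i)%N] (mnu b0)).
  by apply/seteqP; split => w /=; rewrite jump_point_le.
rewrite (_ : mkset _ = set0)//; apply/seteqP; split => // w /=.
by rewrite leNgt (lt_trans b0)// jump_point_gt0.
Qed.

Lemma immigration_process_eq0 t w : Y t w = 0%N <->
  forall k, (k < nu t w)%N -> forall j, (j < I k w)%N -> Zc k j (t - S k w) w = 0%N.
Proof.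
split => [/eqP|H].
  rewrite sum_nat_eq0 => /forallP/= H k kn j jI.
  have /= := H (Ordinal kn); rewrite sum_nat_eq0 => /forallP/(_ (Ordinal jI))/=.
  by move/eqP.
by apply: big1 => k _; apply: big1 => j _; exact: H.
Qed.

Lemma measurable_immigration_eq0 t : 0 <= t -> measurable [set w | Y t w = 0%N].
Proof.
move=> t0.
have -> : [set w | Y t w = 0%N] = [set w | forall k, (k < nu t w)%N ->
    forall j, (j < I k w)%N -> 0 <= t - S k w /\ Zc k j (t - S k w) w = 0%N].
  apply/seteqP; split => w /=.
    move=> /immigration_process_eq0 H k kn j jI; split; last exact: H.
    by rewrite subr_ge0 -jump_point_le.
  by move=> H; apply/immigration_process_eq0 => k kn j jI; case: (H k kn j jI).
apply: measurable_forall_nat => k; apply: measurable_implies.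
  exact: (@measurable_nat_fiber _ _ _ [set i | (k < i)%N] (mnu t0)).
apply: measurable_forall_nat => j; apply: measurable_implies.
  exact: (@measurable_nat_fiber _ _ _ [set i | (j < i)%N] (mI k)).
have [mZk rc _] := ZcP k j.
apply: (@measurable_zero_at_random_time _ _ _ (Zc k j) (fun w => t - S k w)) => //.
by apply: measurable_funB => //; exact: measurable_jump_point.
Qed.

Lemma copies_zero_absorbing : {ae P, forall w, forall k j (s t : R),
  0 <= s <= t -> Zc k j s w = 0%N -> Zc k j t w = 0%N}.
Proof.
pose bad k j := ~` [set w | forall s t : R,
  0 <= s <= t -> Zc k j s w = 0%N -> Zc k j t w = 0%N].
apply: (@negligibleS _ _ _ _ (\bigcup_k \bigcup_j bad k j)).
  by move=> w /= /existsNP[k /existsNP[j wN]]; exists k => //; exists j.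
apply: negligible_bigcup => k; apply: negligible_bigcup => j.
exact: copy_zero_absorbing_path ZP (ZcP k j).
Qed.

(** A clan that arrives between t l and t l.+1 has at time t n an age between
    t n - t l.+1 and t n - t l. By absorption, extinction at the smaller age
    implies extinction at the true age, which implies it at the larger one. *)
Lemma probability_extinct_bounds (t : nat -> R) (n : nat) :
  t 0%N = 0 -> nondecreasing_seq t ->
  expR (- \sum_(l < n)
      (mean_measure r (t l.+1) - mean_measure r (t l)) * (1 - a (t n - t l.+1))) <=
    fine (P [set w | Y (t n) w = 0%N]) <=
  expR (- \sum_(l < n)
      (mean_measure r (t l.+1) - mean_measure r (t l)) * (1 - a (t n - t l))).
Proof.
move=> t0 tnd; case: nuP => _ nu0 _ _ _.
have t_ge0 l : 0 <= t l by rewrite -t0; exact: tnd.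
have mY := measurable_immigration_eq0 (t_ge0 n).
have s0 l : (l < n)%N -> 0 <= t n - t l.
  by move=> ln; rewrite subr_ge0 tnd// ltnW.
have s1 l : (l < n)%N -> 0 <= t n - t l.+1.
  by move=> ln; rewrite subr_ge0 tnd.
have nut0 w : nu (t 0%N) w = 0%N by rewrite t0 nu0.
have in_cell w l k : (nu (t l) w <= k < nu (t l.+1) w)%N -> t l <= S k w <= t l.+1.
  by rewrite leqNgt !jump_point_le// -ltNge => /andP[/ltW -> ->].
rewrite -!lee_fin fineK ?fin_num_measure//.
rewrite -(@cells_extinct t (fun l => t n - t l.+1))//.
rewrite -(@cells_extinct t (fun l => t n - t l))//.
apply/andP; split; apply: (le_measure_negligible _ _ copies_zero_absorbing) => //;
    try exact: measurable_cells.
- move=> w /= Bw; have [abs|] := pselect (forall k j (s u : R),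
    0 <= s <= u -> Zc k j s w = 0%N -> Zc k j u w = 0%N); last by right.
  left; apply/immigration_process_eq0 => k kn j jI.
  have [l ln lk] := @cell_of_index (fun l => nu (t l) w) n k (nut0 w) kn.
  apply: (abs _ _ (t n - t l.+1)); last exact: Bw lk _ jI.
  by rewrite s1//= lerB//; case/andP: (in_cell _ _ _ lk).
- move=> w /= /immigration_process_eq0 Yw.
  have [abs|] := pselect (forall k j (s u : R),
    0 <= s <= u -> Zc k j s w = 0%N -> Zc k j u w = 0%N); last by right.
  left => l ln k lk j jI; have /andP[lS Sl] := in_cell _ _ _ lk.
  have Stn : S k w <= t n by rewrite (le_trans Sl)// tnd.
  apply: (abs _ _ (t n - S k w)); first by rewrite subr_ge0 Stn lerB.
  by apply: Yw => //; rewrite jump_point_le.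
Qed.
End immigration.

(** * Riemann sums of a nonincreasing rate *)

Section nonincreasing_rate.
Context (R : realType) (q : R -> R)
  (q_noninc : forall s t, 0 <= s <= t -> q t <= q s)
  (q01 : forall t, 0 <= t -> 0 <= q t <= 1).

(** Extending q by q(0) to the left makes it monotone on the whole line, hence
    measurable. *)
Let qmax x := q (Num.max 0 x).

Let max0 x : (0 : R) <= Num.max 0 x. Proof. by rewrite le_max lexx. Qed.

Let qmaxE x : 0 <= x -> qmax x = q x.
Proof. by rewrite /qmax => /max_idPr ->. Qed.

Let qmax_ge0 x : 0 <= qmax x. Proof. by case/andP: (q01 (max0 x)). Qed.

Let measurable_qmax : measurable_fun setT qmax.
Proof.
apply: nonincreasing_measurable => // x y xy; apply: q_noninc.
by rewrite max0/= ge_max max0 le_max xy orbT.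
Qed.

(** Hence Q is the mean measure of an intensity q, and the estimates for mean
    measures apply to both r and q. *)
Lemma intensity_nonincreasing : intensity q.
Proof.
split=> [t /q01/andP[]//|t t0].
have mu_t : lebesgue_measure `[0, t] = t%:E :> \bar R.
  rewrite lebesgue_measure_itv/= lte_fin; case: ltP => [|t0']; first by rewrite sube0.
  by rewrite (@le_anti _ _ t 0) ?t0 ?t0'.
have qi : lebesgue_measure.-integrable `[0, t] (EFin \o qmax).
  apply: measurable_bounded_integrable => //.
  - by have := ltry t; rewrite -mu_t.
  - exact: measurable_funTS.
  exists 1; split=> // M M1 x _ /=.
  by rewrite ger0_norm// (le_trans _ (ltW M1))//; case/andP: (q01 (max0 x)).
apply: eq_integrable qi => //.
by move=> x; rewrite inE/= in_itv/= => /andP[x0 _]; rewrite qmaxE.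
Qed.

Local Notation Q := (mean_measure q).

Lemma riemann_sum_bounds (h : R) (n : nat) : 0 < h ->
  h * \sum_(j < n) q (j.+1%:R * h) <= Q (n%:R * h) <= h * \sum_(j < n) q (j%:R * h).
Proof.
move=> h0; elim: n => [|n /andP[IH1 IH2]].
  by rewrite !big_ord0 mul0r mean_measure0 mulr0 lexx.
have nh0 : 0 <= n%:R * h by rewrite mulr_ge0// ltW.
have nhS : n.+1%:R * h = n%:R * h + h by rewrite -natr1 mulrDl mul1r.
have := @mean_measure_bounds _ _ intensity_nonincreasing
  (q (n.+1%:R * h)) (q (n%:R * h)) (n%:R * h) (n.+1%:R * h).
rewrite {1}nhS nh0 lerDl (ltW h0) => /(_ isT).
have -> : n.+1%:R * h - n%:R * h = h by rewrite nhS; ring.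
move=> /(_ _)/wrap[].
  move=> u /andP[nu un]; rewrite !q_noninc//.
    by rewrite nh0 ltW.
  by rewrite un (le_trans nh0 (ltW nu)).
move=> /andP[B1 B2]; rewrite !big_ord_recr/= !mulrDr.
by apply/andP; split; lra.
Qed.

Lemma nonincreasing_rate_le_mean (u : R) : 0 <= u -> u * q u <= Q u.
Proof.
move=> u0.
have := @mean_measure_bounds _ _ intensity_nonincreasing (q u) 1 0 u.
rewrite lexx u0 => /(_ isT); rewrite mean_measure0 !subr0 mulrC => H.
suff /H/andP[] : forall v, 0 < v <= u -> q u <= q v <= 1 by [].
move=> v /andP[v0 vu]; rewrite q_noninc ?vu ?(ltW v0)//=.
by have /q01/andP[] := ltW v0.
Qed.

Local Notation Qoo := (\int[lebesgue_measure]_(u in `[0%R, +oo[) (q u)%:E)%E.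

Lemma cvg_mean_measure_total : (Qoo < +oo)%E ->
  Q n%:R @[n --> \oo] --> fine Qoo.
Proof.
have E (A : set R) : A `<=` `[0, +oo[ ->
   (\int[lebesgue_measure]_(u in A) (q u)%:E =
    \int[lebesgue_measure]_(u in A) (qmax u)%:E)%E.
  move=> A0; apply: eq_integral => u; rewrite inE => /A0/=.
  by rewrite in_itv/= andbT => /qmaxE ->.
move=> Qfin; apply: fine_cvg.
rewrite fineK; last first.
  rewrite ge0_fin_numE//; apply: integral_ge0 => u /=.
  by rewrite in_itv/= andbT lee_fin => /q01/andP[].
rewrite E// [X in X @ _ --> _](_ : _ = fun n : nat =>
    (\int[lebesgue_measure]_(u in `[0%R, n%:R%R]) (qmax u)%:E)%E).
  exact: ge0_cvgn_integral.
by apply/funext => n; apply: E; apply: subset_itvl; rewrite bnd_simp.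
Qed.

Lemma mean_measure_le_total t : (Qoo < +oo)%E -> 0 <= t -> Q t <= fine Qoo.
Proof.
move=> Qfin t0.
have Qnd : nondecreasing_seq (fun n : nat => Q n%:R).
  move=> m n mn; apply: mean_measure_le; first exact: intensity_nonincreasing.
  by rewrite ler_nat mn ler0n.
have -> : fine Qoo = limn (fun n : nat => Q n%:R).
  by apply/esym/cvg_lim => //; exact: cvg_mean_measure_total.
apply: (@le_trans _ _ (Q (Num.bound t)%:R)).
  apply: mean_measure_le; first exact: intensity_nonincreasing.
  by rewrite t0 ltW// archi_boundP.
apply: nondecreasing_cvgn_le => //; apply/cvg_ex; exists (fine Qoo).
exact: cvg_mean_measure_total.
Qed.

End nonincreasing_rate.

(** * The limit of the extinction probability *)

Section asymptotics.
Context (R : realType) (r q x : R -> R) (rho : R)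
  (rP : intensity r) (rho_gt0 : 0 < rho) (r_cvg : r t @[t --> +oo] --> rho)
  (q_noninc : forall s t, 0 <= s <= t -> q t <= q s)
  (q01 : forall t, 0 <= t -> 0 <= q t <= 1)
  (x_bounds : forall (t : nat -> R) (n : nat), t 0%N = 0 -> nondecreasing_seq t ->
    expR (- \sum_(l < n)
      (mean_measure r (t l.+1) - mean_measure r (t l)) * q (t n - t l.+1)) <=
    x (t n) <=
    expR (- \sum_(l < n)
      (mean_measure r (t l.+1) - mean_measure r (t l)) * q (t n - t l))).

Local Notation Q := (mean_measure q).
Local Notation Qoo := (\int[lebesgue_measure]_(u in `[0%R, +oo[) (q u)%:E)%E.

(** The cells of length h are counted backwards from u, so the age of an arrival
    at their ends is a multiple of h; the early cell from 0 to u - n h is dropped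
    in the upper bound. *)
Lemma grid_bounds (h A e u : R) (n : nat) : 0 < h -> 0 <= A ->
  n%:R * h + A <= u -> (forall v, A <= v -> rho - e <= r v <= rho + e) ->
  expR (- (mean_measure r (u - n%:R * h) * q (n%:R * h) +
           (rho + e) * (h * \sum_(j < n) q (j%:R * h)))) <= x u <=
  expR (- ((rho - e) * (h * \sum_(j < n) q (j.+1%:R * h)))).
Proof.
move=> h0 A0 nhu rA.
pose t l : R := if l is l'.+1 then u - (n - l')%:R * h else 0.
have t_nd : nondecreasing_seq t.
  apply/nondecreasing_seqP => -[|l] /=.
    by rewrite subn0 subr_ge0 (le_trans _ nhu)// lerDl.
  by rewrite lerB// ler_wpM2r ?(ltW h0)// ler_nat leq_sub2l.
have tn : t n.+1 = u by rewrite /t subnn mul0r subr0.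
have tA l : A <= t l.+1.
  rewrite /t lerBrDr addrC (le_trans _ nhu)// lerD2r ler_wpM2r ?(ltW h0)//.
  by rewrite ler_nat leq_subr.
have := x_bounds n.+1 erefl t_nd; rewrite tn !big_ord_recl.
set X := \sum_(_ < _) _; set W := \sum_(_ < _) _ => /andP[Xx xW].
have tS (l : 'I_n) : t l.+2 - t l.+1 = h.
  rewrite /t -(subnSK (ltn_ord l)) -natr1; ring.
have m_bounds (l : 'I_n) : (rho - e) * h <=
    mean_measure r (t l.+2) - mean_measure r (t l.+1) <= (rho + e) * h.
  rewrite -{1 2}(tS l); apply: mean_measure_bounds => //.
    by rewrite t_nd// (le_trans A0 (tA _)).
  by move=> v /andP[lv _]; apply: rA; rewrite (le_trans (tA l))// ltW.
have q_ge0 k : 0 <= q (k%:R * h).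
  by have /q01/andP[] : 0 <= k%:R * h by rewrite mulr_ge0// ltW.
have m0 : 0 <= mean_measure r (t 1%N) - mean_measure r (t 0%N).
  by rewrite subr_ge0 mean_measure_le// lexx t_nd.
have X_le : X <= (rho + e) * (h * \sum_(j < n) q (j%:R * h)).
  (* Cells increase with time whereas ages decrease. *)
  rewrite (reindex_inj rev_ord_inj) !mulr_sumr /X; apply: ler_sum => l _ /=.
  rewrite mulrA /bump /= !add1n.
  have -> : u - t l.+2 = (n - l.+1)%:R * h by rewrite /t; ring.
  by apply: ler_wpM2r; rewrite ?q_ge0//; case/andP: (m_bounds l).
have W_ge : (rho - e) * (h * \sum_(j < n) q (j.+1%:R * h)) <= W.
  rewrite (reindex_inj rev_ord_inj) !mulr_sumr /W; apply: ler_sum => l _ /=.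
  rewrite mulrA /bump /= !add1n subnSK//.
  have -> : u - t l.+1 = (n - l)%:R * h by rewrite /t; ring.
  by apply: ler_wpM2r; rewrite ?q_ge0//; case/andP: (m_bounds l).
apply/andP; split.
  apply: le_trans Xx; rewrite ler_expR lerN2; apply: lerD => //=.
  rewrite mean_measure0 subr0 subn0.
  by have -> : u - (u - n%:R * h) = n%:R * h by ring.
apply: (le_trans xW); rewrite ler_expR lerN2; apply: (le_trans W_ge).
rewrite lerDr mulr_ge0//.
by have /q01/andP[] : 0 <= u - t 0%N by rewrite subr0 -tn (le_trans A0 (tA _)).
Qed.

Lemma rate_eventually (e : R) : 0 < e ->
  exists2 A, 0 <= A & forall v, A <= v -> rho - e <= r v <= rho + e.
Proof.
move=> e0; have /cvgrPdist_le/(_ e e0)[A [_ HA]] := r_cvg.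
exists (Num.max 0 (A + 1)); first by rewrite le_max lexx.
move=> v; rewrite ge_max => /andP[_ Av].
have := HA v; rewrite ler_distl => /(_ _)/wrap[]; first by rewrite (lt_le_trans _ Av)// ltrDl.
by move=> /andP[? ?]; apply/andP; split; lra.
Qed.

Lemma riemann_shift h n : \sum_(j < n.+1) q (j%:R * h) =
  q 0 + \sum_(j < n) q (j.+1%:R * h).
Proof. by rewrite big_ord_recl mul0r. Qed.

Lemma extinct_cvg0 : Q t @[t --> +oo] --> +oo -> x t @[t --> +oo] --> 0.
Proof.
move=> Qy; apply/cvgrPdist_le => e e0.
have [A A0 rA] := rate_eventually (divr_gt0 rho_gt0 (ltr0n R 2)).
(* With mesh 1 and rate at least rho / 2, the exponent - (rho / 2) (M - 1)
   equals ln e. *)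
pose M := - ln e * 2 / rho + 1.
have /cvgryPge/(_ M)[B [_ HB]] := Qy.
pose n := Num.bound B.
have MQ : M <= Q n.+1%:R.
  apply: HB; have [B0|B0] := leP 0 B; last by rewrite (lt_le_trans B0).
  by rewrite (lt_trans (archi_boundP B0))// ltr_nat.
have /andP[_ QS] := riemann_sum_bounds q_noninc q01 n.+1 ltr01.
rewrite mulr1 riemann_shift in QS.
have /andP[q00 q01'] := q01 (lexx 0).
exists (n%:R + A); split; first exact: num_real.
move=> u /ltW nu; rewrite sub0r normrN.
have := @grid_bounds 1 A (rho / 2) u n ltr01 A0.
rewrite mulr1 => /(_ nu rA)/andP[Lx Ux].
rewrite ger0_norm ?(le_trans _ Lx) ?expR_ge0//; apply: (le_trans Ux).
rewrite -[leRHS]lnK ?posrE// ler_expR lerNl.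
rewrite mul1r in QS *.
set s := \sum_(_ < _) _ in QS *.
have : - ln e * 2 / rho <= s by rewrite /M in MQ; lra.
rewrite ler_pdivrMr//; lra.
Qed.

(** The upper bound uses a fixed number m of fine cells, enough to capture most
    of Q; the lower bound uses as many fine cells as fit between A and u. *)
Lemma extinct_cvg_exp : (Qoo < +oo)%E ->
  x t @[t --> +oo] --> expR (- (rho * fine Qoo)).
Proof.
move=> Qfin; set K := fine Qoo.
have QK t : 0 <= t -> Q t <= K by exact: mean_measure_le_total.
have K0 : 0 <= K by rewrite -[leLHS](mean_measure0 q) QK.
have /andP[q00 q01'] := q01 (lexx 0).
suff H (eta : R) : 0 < eta -> \forall t \near +oo,
    expR (- (rho * K + eta)) <= x t <= expR (- (rho * K - eta)).
  have lnx : ln (x t) @[t --> +oo] --> - (rho * K).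
    apply/cvgrPdist_le => eta eta0; near=> t.
    have /andP[Lx Ux] : expR (- (rho * K + eta)) <= x t <= expR (- (rho * K - eta)).
      by near: t; exact: H.
    have x0 : 0 < x t by rewrite (lt_le_trans _ Lx)// expR_gt0.
    move: Lx Ux; rewrite -{1 2}[x t]lnK ?posrE// !ler_expR => Lx Ux.
    by rewrite ler_distlC; apply/andP; split; lra.
  have : expR (ln (x t)) @[t --> +oo] --> expR (- (rho * K)).
    by apply: continuous_cvg => //; exact: continuous_expR.
  apply: cvg_trans; apply: near_eq_cvg; near=> t.
  have /andP[Lx _] : expR (- (rho * K + 1)) <= x t <= expR (- (rho * K - 1)).
    by near: t; exact: H.
  by rewrite lnK// posrE (lt_le_trans _ Lx)// expR_gt0.
move=> eta0.
(* The mesh h and the error e on the rate are such that rho h <= eta / 8 and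
   e (K + 1) <= eta / 4. *)
pose h := eta / (8 * rho + eta).
have d0 : 0 < 8 * rho + eta by rewrite addr_gt0// mulr_gt0.
have h0 : 0 < h by rewrite divr_gt0.
have h1 : h <= 1 by rewrite ler_pdivrMr// mul1r lerDr mulr_ge0// ltW.
have rh : 8 * (rho * h) <= eta.
  have -> : 8 * (rho * h) = eta * (8 * rho / (8 * rho + eta)) by rewrite /h; ring.
  by rewrite ler_piMr ?(ltW eta0)// ler_pdivrMr// mul1r lerDl ltW.
pose e := Num.min rho (eta / (4 * (K + 1))).
have K1 : 0 < K + 1 by rewrite ltr_wpDl.
have e0 : 0 < e by rewrite lt_min rho_gt0 divr_gt0// mulr_gt0.
have e_rho : e <= rho by rewrite ge_min lexx.
have eK : 4 * (e * (K + 1)) <= eta.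
  rewrite mulrCA -ler_pdivlMr; last by rewrite mulr_gt0.
  by rewrite ge_min lexx orbT.
have [A A0 rA] := rate_eventually e0.
have [m QKm] : exists m : nat, K - h <= Q (m.+1%:R * h).
  have /cvgrPdist_le/(_ h h0)[N _ HN] := cvg_mean_measure_total q_noninc q01 Qfin.
  have := HN N (leqnn _); rewrite -/K ler_distlC => /andP[KN _].
  exists (Num.bound (N%:R / h)); apply: (le_trans KN); apply: mean_measure_le.
    exact: intensity_nonincreasing.
  rewrite ler0n/= -ler_pdivrMr// ltW// (lt_trans (archi_boundP _))//.
    by rewrite divr_ge0// ltW.
  by rewrite ltr_nat.
pose C := mean_measure r (A + h).
have C0 : 0 <= C.
  by rewrite -[leLHS](mean_measure0 r) mean_measure_le// lexx addr_ge0// ltW.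
(* Beyond the first time the m fine cells cover nearly all of the mass of q;
   beyond the second one the early cell contributes at most eta / 2. *)
exists (Num.max (A + m%:R * h) (A + h + 2 * (C * K) / eta)); split; first exact: num_real.
move=> u; rewrite gt_max => /andP[mu Cu]; apply/andP; split; last first.
  have /andP[_ Ux] := @grid_bounds h A e u m h0 A0
    (eq_ind _ (fun z => z <= u) (ltW mu) _ (addrC _ _)) rA.
  apply: (le_trans Ux); rewrite ler_expR lerN2.
  have /andP[_] := riemann_sum_bounds q_noninc q01 m.+1 h0.
  rewrite riemann_shift mulrDr; set s := \sum_(_ < _) _ => QS.
  have : K - 2 * h <= h * s.
    have : h * q 0 <= h by rewrite ler_piMr// ltW.
    by move: QS QKm; lra.
  nra.
(* As many cells as possible, so that the early cell ends before A + h. *)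
pose n := Num.trunc ((u - A) / h).
have CK0 : 0 <= 2 * (C * K) / eta.
  by rewrite divr_ge0 ?(ltW eta0)// mulr_ge0// mulr_ge0.
have Ahu : A + h < u by rewrite (le_lt_trans _ Cu)// lerDl.
have /andP[nu un] : n%:R <= (u - A) / h < n.+1%:R.
  by apply: truncn_itv; rewrite divr_ge0 ?(ltW h0)// subr_ge0; lra.
move: nu un; rewrite ler_pdivlMr// ltr_pdivrMr// -natr1 mulrDl mul1r => nu un.
have nhu : n%:R * h + A <= u by lra.
have /andP[Lx _] := @grid_bounds h A e u n h0 A0 nhu rA.
apply: le_trans Lx; rewrite ler_expR lerN2.
have nh0 : 0 < n%:R * h by lra.
have first_cell : mean_measure r (u - n%:R * h) * q (n%:R * h) <= eta / 2.
  have qn : q (n%:R * h) <= K / (n%:R * h).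
    rewrite ler_pdivlMr// mulrC (le_trans _ (QK _ (ltW nh0)))//.
    by apply: nonincreasing_rate_le_mean => //; exact: ltW.
  have rn : mean_measure r (u - n%:R * h) <= C.
    by apply: mean_measure_le => //; apply/andP; split; lra.
  apply: (@le_trans _ _ (C * (K / (n%:R * h)))).
    apply: ler_pM => //; last by case/andP: (q01 (ltW nh0)).
    by rewrite -[leLHS](mean_measure0 r) mean_measure_le// lexx; lra.
  rewrite mulrA ler_pdivrMr//.
  have : 2 * (C * K) / eta <= n%:R * h by lra.
  by rewrite ler_pdivrMr//; lra.
have others : h * \sum_(j < n) q (j%:R * h) <= h + K.
  apply: (@le_trans _ _ (h * \sum_(j < n.+1) q (j%:R * h))).
    rewrite ler_wpM2l ?(ltW h0)// big_ord_recr/= lerDl.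
    by case/andP: (q01 (ltW nh0)).
  rewrite riemann_shift mulrDr; apply: lerD; first by rewrite ler_piMr// ltW.
  have /andP[/le_trans->//] := riemann_sum_bounds q_noninc q01 n h0.
  by rewrite QK// ltW.
have s0 : 0 <= rho + e by lra.
have := ler_wpM2l s0 others; nra.
Unshelve. all: by end_near.
Qed.

End asymptotics.

Theorem theorem4p1 (R : realType)
    (* the branching process Z *)
    (d0 : measure_display) (T0 : measurableType d0) (P0 : probability T0 R)
    (mu : R) (f : R -> R) (Z : R -> T0 -> nat)
    (mu_gt0 : 0 < mu)
    (ZP : markov_branching_process P0 mu f Z)
    (* the immigration *)
    (d : measure_display) (T : measurableType d) (P : probability T R)
    (r : R -> R) (nu : R -> T -> nat) (S : nat -> T -> R)
    (g : R -> R) (I : nat -> T -> nat) (Zc : nat -> nat -> R -> T -> nat)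
    (rP : intensity r)
    (nuP : poisson_process P r nu)
    (SP : jump_points nu S)
    (IP : forall k, has_pgf P (I k) g)
    (ZcP : forall k j, copy_of P0 Z P (Zc k j))
    (indep : mutually_independent P (sources nu I Zc))
    (* (a) *)
    (rho : R) (rho_gt0 : 0 < rho)
    (r_cvg : r t @[t --> +oo] --> rho)
    (* (b) *)
    (gamma : R) (L : R -> R)
    (gammaP : 0 < gamma <= 1) (LP : slowly_varying L)
    (fE : forall s, 0 <= s < 1 ->
       f s = s + (1 - s) `^ (gamma + 1) * L (1 / (1 - s)))
    (* (c) *)
    (alpha : R) (l : R -> R)
    (alphaP : 0 < alpha <= 1) (lP : slowly_varying l)
    (gE : forall s, 0 < s < 1 ->
       g s = 1 - (1 - s) `^ alpha * l (1 / (1 - s))) :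
  let F (t s : R) := pgf P0 (Z t) s in
  let q (t : R) := 1 - g (F t 0) in
  let Q (t : R) := \int[lebesgue_measure]_(u in `[0, t]) q u in
  let Qoo := (\int[lebesgue_measure]_(u in `[0%R, +oo[) (q u)%:E)%E in
  let Y := immigration_process nu S I Zc in
  (Q t @[t --> +oo] --> +oo ->
     P [set w | (0 < Y t w)%N] @[t --> +oo] --> 1%:E) /\
  ((Qoo < +oo)%E ->
     P [set w | (0 < Y t w)%N] @[t --> +oo] -->
       (1 - expR (- (rho * fine Qoo)))%:E).
Proof.
move=> F q Q Qoo Y.
have a01 t (t0 : 0 <= t) : 0 <= g (F t 0) <= 1 := clan_ext_01 ZP IP t0.
have q01 t : 0 <= t -> 0 <= q t <= 1.
  by move=> /a01/andP[a0 a1]; rewrite /q subr_ge0 a1 lerBlDr lerDl.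
have q_noninc s t : 0 <= s <= t -> q t <= q s.
  by move=> st; rewrite lerB//; exact: (clan_ext_le ZP IP ZcP).
pose x t := fine (P [set w | Y t w = 0%N]).
have x_bounds (t : nat -> R) (n : nat) : t 0%N = 0 -> nondecreasing_seq t ->
    expR (- \sum_(l < n)
      (mean_measure r (t l.+1) - mean_measure r (t l)) * q (t n - t l.+1)) <=
    x (t n) <=
    expR (- \sum_(l < n)
      (mean_measure r (t l.+1) - mean_measure r (t l)) * q (t n - t l)).
  move=> t0 tnd; exact: (probability_extinct_bounds ZP rP nuP SP IP ZcP indep n t0 tnd).
have PY : \forall t \near +oo, (1 - x t)%:E = P [set w | (0 < Y t w)%N].
  near=> t; have t0 : 0 <= t by near: t; exact: nbhs_pinfty_ge.
  have mY := measurable_immigration_eq0 nuP SP IP ZcP t0.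
  have -> : [set w | (0 < Y t w)%N] = ~` [set w | Y t w = 0%N].
    by apply/seteqP; split => w /=; rewrite lt0n => /eqP.
  by rewrite probability_setC// EFinB fineK// fin_num_measure.
have cvgP p : x t @[t --> +oo] --> p ->
    P [set w | (0 < Y t w)%N] @[t --> +oo] --> (1 - p)%:E.
  move=> xp; apply: cvg_trans (near_eq_cvg PY) _.
  apply: cvg_EFin; first exact: nearW.
  by apply: cvgB => //; exact: cvg_cst.
split => HQ; last exact/cvgP/(extinct_cvg_exp rP).
by rewrite -[X in X%:E]subr0; apply/cvgP/(extinct_cvg0 rP rho_gt0 r_cvg q_noninc).
Unshelve. all: by end_near.
Qed.
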